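(* Let $G$ be a countable group which is not finitely generated. If there exists a comeager conjugacy class in $\Xi(G)$, then the generic element of $\Xi(G)$ is minimal, i.e., the set $\Xi_{\mathrm{min}}(G)$ is comeager in $\Xi(G)$.
   Context: $\Omega$ denotes the Cantor space; $\mathrm{Homeo}(\Omega)$ carries the uniform convergence topology. $\Xi(G)=\mathrm{Hom}(G,\mathrm{Homeo}(\Omega))$ is the Polish space of actions of the countable group $G$ on $\Omega$ by homeomorphisms, a closed subspace of $\mathrm{Homeo}(\Omega)^G$. $\mathrm{Homeo}(\Omega)$ acts on it by conjugation, $(f\cdot\xi)(g)=f\xi(g)f^{-1}$; orbits are called conjugacy classes. $\Xi_{\mathrm{min}}(G)$ is the set of $\xi\in\Xi(G)$ which are minimal, i.e., such that $\Omega$ has no proper non-empty closed $\xi$-invariant subset. *)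

(* Defs.v *)
From HB Require Import structures.
From mathcomp Require Import all_boot.
From mathcomp Require Import all_classical topology cantor borel_hierarchy.

Set Implicit Arguments.
Unset Strict Implicit.
Unset Printing Implicit Defensive.

Local Open Scope classical_set_scope.
Local Open Scope group_scope.

Definition comeager (T : topologicalType) (A : set T) : Prop :=
  exists2 S : set T, Gdelta_dense S & S `<=` A.

Definition subgroup_generated (G : groupType) (A : set G) : set G :=
  smallest (fun H : set G => group_closed (mem H)) A.

Definition finitely_generated (G : groupType) : Prop :=
  exists2 A : set G, finite_set A & subgroup_generated A = [set: G].

Definition homeomorphism (T : topologicalType) : set (T -> T) :=
  [set f | continuous f /\
    exists g : T -> T, [/\ continuous g, cancel f g & cancel g f]].

Record homeo := Homeo {
  homeo_fun :> cantor_space -> cantor_space;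
  homeoP : homeomorphism homeo_fun }.

HB.instance Definition _ := gen_eqMixin homeo.
HB.instance Definition _ := gen_choiceMixin homeo.

(* Without the cast to [{uniform _ -> _}], the induced topology would be that
   of pointwise convergence. *)
HB.instance Definition _ := Topological.copy homeo
  (initial_topology
     (homeo_fun : homeo -> {uniform cantor_space -> cantor_space})).

Lemma homeo_ext (f g : homeo) : f =1 g -> f = g.
Proof.
case: f g => [f hf] [g hg] /= /funext fg.
by subst g; congr Homeo; exact: Prop_irrelevance.
Qed.

Lemma homeomorphism_id : homeomorphism (@id cantor_space).
Proof. by split; [|exists id; split] => // x; exact: cvg_id. Qed.

Lemma homeomorphism_comp (f g : homeo) : homeomorphism (f \o g).
Proof.
have [cf [f' [cf' fK f'K]]] := homeoP f.
have [cg [g' [cg' gK g'K]]] := homeoP g.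
split; first by move=> x; apply: continuous_comp; [exact: cg|exact: cf].
exists (g' \o f'); split; last 2 first.
- exact: can_comp.
- exact: can_comp.
- by move=> x; apply: continuous_comp; [exact: cf'|exact: cg'].
Qed.

Lemma homeo_inv_ex (f : homeo) :
  exists g, [/\ homeomorphism g, cancel f g & cancel g f].
Proof.
have [cf [g [cg fK gK]]] := homeoP f.
by exists g; split => //; split => //; exists f.
Qed.

Definition homeo1 : homeo := Homeo homeomorphism_id.
Definition homeo_mul (f g : homeo) : homeo := Homeo (homeomorphism_comp f g).

Lemma homeomorphism_inv (f : homeo) :
  homeomorphism (projT1 (cid (homeo_inv_ex f))).
Proof. by case: (cid _) => g []. Qed.

Definition homeo_inv (f : homeo) : homeo := Homeo (homeomorphism_inv f).

Lemma homeoK (f : homeo) : cancel f (homeo_inv f).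
Proof. by rewrite /homeo_inv /=; case: (cid _) => g []. Qed.

Lemma homeoVK (f : homeo) : cancel (homeo_inv f) f.
Proof. by rewrite /homeo_inv /=; case: (cid _) => g []. Qed.

Fact homeo_mulA : associative homeo_mul.
Proof. by move=> f g h; apply: homeo_ext. Qed.
Fact homeo_mul1 : left_id homeo1 homeo_mul.
Proof. by move=> f; apply: homeo_ext. Qed.
Fact homeo_mulr1 : right_id homeo1 homeo_mul.
Proof. by move=> f; apply: homeo_ext. Qed.
Fact homeo_mulV : left_inverse homeo1 homeo_inv homeo_mul.
Proof. by move=> f; apply: homeo_ext => x; exact: homeoK. Qed.
Fact homeo_mulrV : right_inverse homeo1 homeo_inv homeo_mul.
Proof. by move=> f; apply: homeo_ext => x; exact: homeoVK. Qed.

HB.instance Definition _ := isGroup.Build homeo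
  homeo_mulA homeo_mul1 homeo_mulr1 homeo_mulV homeo_mulrV.

Section Actions.
Variable G : groupType.

Record Xi := Action {
  act :> G -> homeo;
  actM : {morph act : g h / g * h} }.

HB.instance Definition _ := gen_eqMixin Xi.
HB.instance Definition _ := gen_choiceMixin Xi.

HB.instance Definition _ := Topological.copy Xi
  (initial_topology (act : Xi -> prod_topology (fun _ : G => homeo))).

Fact conj_action_subproof (f : homeo) (xi : Xi) :
  {morph (fun g => f * xi g * f^-1) : g h / g * h}.
Proof. by move=> g h; rewrite actM !mulgA mulgVK. Qed.

Definition conj_action (f : homeo) (xi : Xi) : Xi :=
  Action (conj_action_subproof f xi).

Definition conjugacy_class (xi : Xi) : set Xi :=
  [set conj_action f xi | f in [set: homeo]].

Definition action_invariant (xi : Xi) (F : set cantor_space) : Prop :=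
  forall g : G, xi g @` F `<=` F.

Definition minimal_action (xi : Xi) : Prop :=
  forall F : set cantor_space,
    closed F -> F !=set0 -> action_invariant xi F -> F = [set: cantor_space].

Definition Xi_min : set Xi := [set xi | minimal_action xi].

End Actions.

(* Main.v *)
Require Import Defs.
From HB Require Import structures.
From mathcomp Require Import all_boot.
From mathcomp Require Import all_classical topology cantor borel_hierarchy.

Set Implicit Arguments.
Unset Strict Implicit.
Unset Printing Implicit Defensive.

Local Open Scope classical_set_scope.
Local Open Scope group_scope.

(** Let [xi] have a comeager conjugacy class and suppose that it is not minimal:
    some nonempty clopen [B] is avoided by a whole orbit of [xi].  For an action
    [eta] and a clopen [C], let [returns eta C] be the set of those [g] for which
    [eta g] maps some point of [C] into [C].  Conjugating [xi] by [f] turns [B]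
    into [f @` B] and does not change the set of return elements, so every
    element of the class of [xi] lies, for some clopen [C], in the set
    [pattern (returns xi B) C] of the actions that have an orbit avoiding [C] and
    the same return elements to [C] as [xi] to [B].  There are only countably many
    clopen sets and these pattern sets are closed; the space of actions is a Baire
    space ([Xi_baire]), so it suffices to prove that each of them is nowhere dense
    ([pattern_nowhere_dense]) to reach a contradiction.

    A basic neighbourhood of an action [xi] only constrains finitely many group
    elements.  They generate a subgroup [H], and [H] is proper because [G] is not
    finitely generated.  Suppose that an orbit of [xi] avoids [C], so that the
    closed invariant set [K] of all points whose orbit avoids [C] is nonempty.
    Let [G] act on the functions [w] from the cosets [Hg] to the Cantor space by
    [(g.w)(c) = xi g (w (c g))], which mixes the action [xi] on the values with
    the translations of the cosets.  The evaluation at the coset [H] is an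
    [H]-equivariant map onto [xi], so any closed invariant set of such functions
    on which the evaluation is still onto gives, once it is identified with the
    Cantor space, an action in the given neighbourhood ([realization]).  For the
    set of all functions, any [g] outside [H] is a return element, since the
    values at [H] and [Hg] are independent.  For the set of the functions that
    take values in [K] at all cosets but at most one, no [g] outside [H] is, since
    one of the values at [H] and [Hg] never visits [C].  Hence no neighbourhood has a
    constant set of return elements.

    The identification with the Cantor space has to respect the first [n]
    coordinates of the evaluation map.  It is obtained fibre by fibre from
    Brouwer's characterization, in the form that a nonempty perfect closed subset
    of the Cantor space is the image of a continuous injection of the Cantor space
    ([perfect_param]). *)

(** * Agreement of binary sequences and the topology of the Cantor space *)

Definition agree (n : nat) (x y : cantor_space) : Prop :=
  forall i, (i < n)%N -> x i = y i.

Lemma agree_sym n x y : agree n x y -> agree n y x.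
Proof. by move=> xy i /xy. Qed.

Lemma agree_trans n y x z : agree n x y -> agree n y z -> agree n x z.
Proof. by move=> xy yz i ni; rewrite xy// yz. Qed.

Lemma agree_le m n x y : (m <= n)%N -> agree n x y -> agree m x y.
Proof. by move=> mn xy i im; apply: xy; exact: leq_trans mn. Qed.

Lemma agree_all x y : (forall n, agree n x y) -> x = y.
Proof. by move=> xy; apply/funext => i; exact: (xy i.+1). Qed.

Lemma nbhs_agree n x : nbhs x (agree n x).
Proof.
elim: n => [|n IH]; first by apply: filterS filterT => y _ i.
have cn : nbhs x [set y : cantor_space | y n = x n].
  apply: (@proj_continuous _ (fun=> bool) n x [set b | b = x n]).
  by rewrite nbhs_principalE.
apply: filterS (filterI IH cn) => y [xy yn] i; rewrite ltnS leq_eqVlt.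
by case/predU1P => [->|/xy].
Qed.

Lemma nbhs_cantorP (x : cantor_space) U :
  nbhs x U <-> exists n, agree n x `<=` U.
Proof.
split; last by case=> n /filterS; apply; exact: nbhs_agree.
pose F := filter_from [set: nat] (fun n => agree n x).
have FF : Filter F.
  apply: filter_from_filter; first by exists 0.
  move=> i j _ _; exists (maxn i j) => // y xy.
  by split; apply: agree_le xy; rewrite ?leq_maxl ?leq_maxr.
suff : F --> x by move=> /[apply] -[n _ nU]; exists n.
apply/cvg_sup => i; apply/cvg_image.
  rewrite eqEsubset; split => // b _; exists (fun=> b) => //.
move=> A xA; exists [set y : cantor_space | A (y i)].
  exists i.+1 => // y /(_ i (ltnSn i)) /= <-; exact: nbhs_singleton xA.
rewrite eqEsubset; split=> [_ [y Ay <-]//|b Ab].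
by exists (fun=> b).
Qed.

(** Compactness of the Cantor space as a fan theorem: a monotone property of the
    depth that holds locally holds everywhere at a single depth. *)
Lemma cantor_fan (P : nat -> set cantor_space) :
  (forall m n, (m <= n)%N -> P m `<=` P n) ->
  (forall x, exists n, agree n x `<=` P n) ->
  exists n, forall x, P n x.
Proof.
move=> Pmono Ploc.
have /compact_near_coveringP/(_ _ \oo (fun n x => P n x) _)[] :=
  cantor_space_compact.
  move=> x _; have [n nP] := Ploc x.
  exists (agree n x, [set m | (n <= m)%N]).
    by split; [exact: nbhs_agree|exists n].
  by case=> y m [/= xy nm]; exact: Pmono (nP _ xy).
move=> n _ nP; exists n => x; apply: (nP n) => //=.
Qed.

Lemma continuous_agreeP (f : cantor_space -> cantor_space) :
  continuous f <->
  forall x m, exists n, forall y, agree n x y -> agree m (f x) (f y).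
Proof.
split=> [cf x m|cf x U].
  by have /nbhs_cantorP[n nU] := cf x _ (nbhs_agree m (f x)); exists n.
case/nbhs_cantorP => m mU; apply/nbhs_cantorP.
by have [n nm] := cf x m; exists n => y /nm /mU.
Qed.

Lemma uniform_agree (f : cantor_space -> cantor_space) m : continuous f ->
  exists n, forall x y, agree n x y -> agree m (f x) (f y).
Proof.
move=> /continuous_agreeP cf.
apply: (@cantor_fan (fun n x => forall y, agree n x y -> agree m (f x) (f y))).
  by move=> i j ij x xi y xy; apply/xi/(agree_le ij).
move=> x; have [n xn] := cf x m; exists n => y xy z yz.
by apply: agree_trans (xn z _); [exact/agree_sym/xn|exact: agree_trans yz].
Qed.

Lemma continuous_coordP (f : cantor_space -> cantor_space) :
  (forall i, continuous (fun x => f x i)) -> continuous f.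
Proof.
move=> cf; apply/continuous_agreeP => x m.
suff /nbhs_cantorP[n nm] : nbhs x [set y | agree m (f x) (f y)] by exists n.
elim: m => [|m IH]; first by apply: filterS filterT => y _ i.
have cm : nbhs x [set y | f y m = f x m].
  by apply: (cf m x [set b | b = f x m]); rewrite nbhs_principalE.
apply: filterS (filterI IH cm) => y [xy ym] i; rewrite ltnS leq_eqVlt.
by case/predU1P => [->|/xy].
Qed.

Lemma closed_agreeP (A : set cantor_space) :
  closed A <-> forall x, (forall n, exists2 y, agree n x y & A y) -> A x.
Proof.
split=> [Acl x xA|Acl x clx].
  apply: Acl => U /nbhs_cantorP[n nU]; have [y xy Ay] := xA n.
  by exists y; split => //; exact: nU.
by apply: Acl => n; have [y [Ay xy]] := clx _ (nbhs_agree n x); exists y.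
Qed.

(** * Perfect closed sets are injective images of the Cantor space *)
Section perfect_parametrization.
Variables (D : set cantor_space) (d0 : cantor_space).
Hypotheses (Dd0 : D d0) (D_closed : closed D).
Hypothesis D_perfect :
  forall n x, D x -> exists2 y, D y & agree n x y /\ x <> y.

Lemma neq_split (x y : cantor_space) : x <> y ->
  exists2 m, agree m x y & x m != y m.
Proof.
move=> xy; have ex : exists m, x m != y m.
  apply: contra_notP xy => /forallNP xy; apply/funext => m.
  by apply/eqP/negPn/negP/xy.
exists (ex_minn ex); last by case: ex_minnP.
case: ex_minnP => m _ mmin i im; apply/eqP; apply: contraTT im => /mmin.
by rewrite -leqNgt.
Qed.

(** The branching depth [q.1] is the first one past [p.1]: no point of [D] in the
    cylinder of [p.2] is lost when passing to the two children, which makes the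
    parametrization onto.  The premise is inside the existential so that [q] can
    be chosen as a total function of the node. *)
Lemma first_split (p : nat * cantor_space) :
  exists q : nat * (bool -> cantor_space), D p.2 ->
  [/\ (p.1 <= q.1)%N,
      forall z, D z -> agree p.1 p.2 z -> agree q.1 p.2 z &
      forall b, [/\ D (q.2 b), agree q.1 p.2 (q.2 b) & q.2 b q.1 = b]].
Proof.
case: p => n x /=; have [Dx|Dx] := pselect (D x); last by exists (0, fun=> x).
pose splits m := `[< (n <= m)%N /\ exists y, [/\ D y, agree m x y & x m != y m] >].
have ex : exists m, splits m.
  have [y Dy [xy /neq_split[m xym mxy]]] := D_perfect n Dx.
  exists m; apply/asboolP; split; last by exists y.
  by rewrite leqNgt; apply: contraNN mxy => /xy ->.
have [m /asboolP[nm [y [Dy xy mxy]]] mmin] := ex_minnP ex.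
exists (m, fun b => if b == x m then x else y) => _ /=; split=> //.
  move=> z Dz xz i im; apply/eqP; apply: contraPT (im) => ixz.
  have /neq_split[j xzj jxz] : x <> z by move=> E; rewrite E eqxx in ixz.
  have mj : (m <= j)%N.
    apply: mmin; apply/asboolP; split; last by exists z.
    by rewrite leqNgt; apply: contraNN jxz => /xz ->.
  by rewrite (xzj i) ?eqxx// in ixz; exact: leq_trans mj.
move=> b; case: eqP => [->//|/eqP bx]; split => //.
by case: b (x m) (y m) bx mxy => [] [] [].
Qed.

Let split p := projT1 (cid (first_split p)).
Let splitP p := projT2 (cid (first_split p)).
Let child (p : nat * cantor_space) b : nat * cantor_space :=
  ((split p).1.+1, (split p).2 b).

(** The node reached by following the bits of [b] through the successive
    branchings of [D]: a depth, with a point of [D] naming the cylinder. *)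
Fixpoint node (b : nat -> bool) k : nat * cantor_space :=
  if k is l.+1 then child (node b l) (b l) else (0, d0).

Lemma node_in b k : D (node b k).2.
Proof. by elim: k => //= k /splitP[_ _ /(_ (b k))[]]. Qed.

Lemma node_ltn b k : ((node b k).1 < (node b k.+1).1)%N.
Proof. by rewrite ltnS; have [] := splitP (node_in b k). Qed.

Lemma node_ge b k : (k <= (node b k).1)%N.
Proof. by elim: k => // k IH; exact: leq_ltn_trans IH (node_ltn b k). Qed.

Lemma node_le b k l : (k <= l)%N -> ((node b k).1 <= (node b l).1)%N.
Proof.
elim: l => [|l IH]; first by rewrite leqn0 => /eqP ->.
rewrite leq_eqVlt => /predU1P[->//|/IH kl].
exact: leq_trans kl (ltnW (node_ltn b l)).
Qed.

Lemma node_agree b k l : (k <= l)%N ->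
  agree (node b k).1 (node b k).2 (node b l).2.
Proof.
elim: l => [|l IH]; first by rewrite leqn0 => /eqP ->.
rewrite leq_eqVlt => /predU1P[->//|]; rewrite ltnS => kl.
apply: agree_trans (IH kl) _ => /=.
have [nm _ /(_ (b l))[_ + _]] := splitP (node_in b l); apply: agree_le.
exact: leq_trans (node_le b kl) nm.
Qed.

Lemma eq_node b c k : agree k b c -> node b k = node c k.
Proof.
elim: k => //= k IH bc; rewrite IH ?bc//.
by apply: agree_le bc.
Qed.

Definition branch (b : cantor_space) : cantor_space :=
  fun i => (node b i.+1).2 i.

Lemma node_branch b k : agree (node b k).1 (node b k).2 (branch b).
Proof.
move=> i ik; rewrite /branch; have [ki|ki] := leqP k i.+1.
  by rewrite (node_agree ki).
by rewrite (node_agree (ltnW ki))//; exact: node_ge.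
Qed.

(** The bits of [b] can be read off from [branch b] at the branching depths;
    this is where injectivity comes from. *)
Lemma branch_split b k : branch b (split (node b k)).1 = b k.
Proof.
rewrite -(node_branch (k := k.+1)) //=.
by have [_ _ /(_ (b k))[]] := splitP (node_in b k).
Qed.

Lemma branch_in b : D (branch b).
Proof.
apply: (closed_agreeP D).1 D_closed _ _ => n.
exists (node b n).2; last exact: node_in.
by apply/agree_sym/(agree_le (node_ge b n)); exact: node_branch.
Qed.

Lemma branch_inj : injective branch.
Proof.
move=> b c bc; apply: agree_all; elim=> // k IH i.
rewrite ltnS leq_eqVlt => /predU1P[->|/IH//].
by rewrite -[LHS]branch_split -[RHS]branch_split bc (eq_node IH).
Qed.

Lemma branch_surj z : D z -> exists b, branch b = z.
Proof.
move=> Dz.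
pose fix nz k := if k is l.+1 then child (nz l) (z (split (nz l)).1) else (0, d0).
pose b : cantor_space := fun k => z (split (nz k)).1.
have nzE k : nz k = node b k by elim: k => [|k IH] //=; rewrite -IH.
exists b; apply: agree_all => n; apply: agree_le (node_ge b n) _.
apply: (@agree_trans _ (node b n).2); first exact/agree_sym/node_branch.
elim: n => // n IH /= i.
have [_ /(_ z Dz IH) xz /(_ (b n))[_ xb bE]] := splitP (node_in b n).
rewrite ltnS leq_eqVlt => /predU1P[->|ni]; first by rewrite bE /b nzE.
by rewrite -xb// xz.
Qed.

Lemma branch_continuous : continuous branch.
Proof.
apply/continuous_agreeP => x m; exists m => y xy i im.
by rewrite /branch (@eq_node x y i.+1)//; exact: agree_le xy.
Qed.

Lemma perfect_param : exists f : cantor_space -> cantor_space,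
  [/\ continuous f, injective f & range f = D].
Proof.
exists branch; split; [exact: branch_continuous|exact: branch_inj|].
rewrite eqEsubset; split=> [_ [b _ <-]|z /branch_surj[b <-]]; first exact: branch_in.
by exists b.
Qed.

End perfect_parametrization.

(** * Uniform neighbourhoods of homeomorphisms and of actions *)

(** On a compact space any neighbourhood of the diagonal is an entourage, so
    that only the topology of the Cantor space enters. *)
Lemma entourage_agree n :
  entourage [set xy : cantor_space * cantor_space | agree n xy.1 xy.2].
Proof.
have /compact_near_coveringP/(_ _ (powerset_filter_from entourage)
    (fun E x => forall y, E (x, y) -> agree n x y) _)[] := cantor_space_compact.
  move=> x _; have := nbhs_agree n x.
  rewrite -nbhs_entourageE => -[E entE Ex].
  have sE := entourage_split_ent entE.
  near=> z F => y Fzy.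
  apply: (@agree_trans _ x).
    by apply: agree_sym; near: z; exact: nbhs_agree.
  apply: Ex; apply/xsectionP; apply: (entourage_split z entE).
    by apply/xsectionP; near: z; exact: nbhs_entourage.
  exact: (near (small_ent_sub sE) F).
move=> M [MF _ [E ME]] MP; apply: filterS (MF _ ME) => -[x y] Exy.
exact: MP ME x I y Exy.
Unshelve. all: by end_near. Qed.

Lemma entourage_cantorP (E : set (cantor_space * cantor_space)) :
  entourage E -> exists n, forall x y, agree n x y -> E (x, y).
Proof.
move=> entE.
have [|x|n nE] := @cantor_fan (fun n x => forall y, agree n x y -> E (x, y)).
- by move=> m n mn x xE y /(agree_le mn) /xE.
- have /nbhs_cantorP[n nE] := nbhs_entourage x (entourage_split_ent entE).
  have /nbhs_cantorP[m mE] :=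
     nbhs_entourage x (entourage_inv (entourage_split_ent entE)).
  exists (maxn m n) => y xy z yz; apply: (entourage_split x entE).
    have /mE/xsectionP // : agree m x y by apply: agree_le xy; exact: leq_maxl.
  apply/xsectionP/nE; apply: agree_le (agree_trans xy yz); exact: leq_maxr.
- by exists n.
Qed.

Lemma nbhs_homeoP (f : homeo) (U : set homeo) :
  nbhs f U <->
  exists n, (fun h : homeo => forall x, agree n (f x) (h x)) `<=` U.
Proof.
split.
  case=> _ [[W oW <-] Wf WU].
  have /uniform_nbhs[E [/entourage_cantorP[n nE] EW]] := open_nbhs_nbhs (conj oW Wf).
  by exists n => h fh; apply/WU/EW => x _; exact: nE.
case=> n /filterS; apply.
have : nbhs (f : {uniform cantor_space -> cantor_space})
    [set h | forall x, agree n (f x) (h x)].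
  apply/uniform_nbhs; exists [set xy | agree n xy.1 xy.2].
  by split; [exact: entourage_agree|move=> h fh x; exact: fh].
exact: (@initial_continuous homeo {uniform cantor_space -> cantor_space}
  homeo_fun).
Qed.

Section action_space.
Variables (G : groupType) (e : G -> nat).
Hypothesis e_inj : injective e.
Implicit Types xi eta zeta : Xi G.

(** Through the injection [e], the parameter [k] bounds both the set of group
    elements on which the actions are compared and the precision, so that these
    sets form a decreasing neighbourhood base indexed by [nat]. *)
Definition act_agree (k : nat) xi eta : Prop :=
  forall g, (e g < k)%N -> forall x, agree k (xi g x) (eta g x).

Lemma act_agree_le m n xi eta : (m <= n)%N ->
  act_agree n xi eta -> act_agree m xi eta.
Proof.
move=> mn xieta g gm x; apply: (agree_le mn); apply: xieta.
exact: leq_trans mn.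
Qed.

Lemma act_agree_trans k xi eta zeta :
  act_agree k xi eta -> act_agree k eta zeta -> act_agree k xi zeta.
Proof.
by move=> xe ez g gk x; apply: agree_trans (xe g gk x) (ez g gk x).
Qed.

Lemma act_agree_sym k xi eta : act_agree k xi eta -> act_agree k eta xi.
Proof. by move=> xe g gk x; exact/agree_sym/xe. Qed.

Lemma nbhs_act_agree_at (g : G) n xi :
  nbhs xi [set eta : Xi G | forall x, agree n (xi g x) (eta g x)].
Proof.
have c : continuous (fun eta : Xi G => eta g).
  move=> eta; apply: (@continuous_comp _ (prod_topology (fun _ : G => homeo)) _
     (@act G) (@proj _ (fun=> homeo) g)).
    exact: initial_continuous.
  exact: proj_continuous.
apply: (c xi [set h : homeo | forall x, agree n (xi g x) (h x)]).
by apply/nbhs_homeoP; exists n.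
Qed.

Lemma nbhs_act_agree k xi : nbhs xi (act_agree k xi).
Proof.
suff : forall l, nbhs xi [set eta : Xi G | forall g, (e g < l)%N -> forall x,
    agree k (xi g x) (eta g x)] by exact.
elim=> [|l IH]; first by apply: filterS filterT.
have [[g gl]|/forallNP ng] := pselect (exists g, e g = l).
  apply: filterS (filterI IH (nbhs_act_agree_at g k xi)) => eta [el eg] h.
  by rewrite ltnS leq_eqVlt -gl => /predU1P[/e_inj->//|]; rewrite gl; exact: el.
apply: filterS IH => eta el h.
by rewrite ltnS leq_eqVlt => /predU1P[/ng//|]; exact: el.
Qed.

Lemma nbhs_actP xi (U : set (Xi G)) :
  nbhs xi U <-> exists k, act_agree k xi `<=` U.
Proof.
split; last by case=> k /filterS; apply; exact: nbhs_act_agree.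
pose F := filter_from [set: nat] (fun n => act_agree n xi).
have FF : Filter F.
  apply: filter_from_filter; first by exists 0.
  move=> i j _ _; exists (maxn i j) => // y xy.
  by split; apply: act_agree_le xy; rewrite ?leq_maxl ?leq_maxr.
suff : F --> xi by move=> /[apply] -[n _ nU]; exists n.
suff Fxi : (@act G @ F) --> (act xi : prod_topology (fun _ : G => homeo)).
  move=> V [_ [[W oW <-] Wxi WV]].
  exact: filterS WV (Fxi _ (open_nbhs_nbhs (conj oW Wxi))).
apply/cvg_sup => g; apply/cvg_image.
  by rewrite eqEsubset; split => // h _; exists (fun=> h).
move=> V /nbhs_homeoP[n nV].
exists [set f : prod_topology (fun _ : G => homeo) | V (f g)].
  exists (maxn n (e g).+1) => // eta xieta; apply: nV => x.
  by apply: agree_le (xieta g _ x); rewrite ?leq_maxl// leq_maxr.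
rewrite eqEsubset; split=> [_ [f Vf <-]//|h Vh].
by exists (fun=> h).
Qed.

End action_space.

(** * The space of actions is a Baire space *)

Lemma homeo_continuous (f : homeo) : continuous f.
Proof. exact: (homeoP f).1. Qed.

Lemma act1 (G : groupType) (xi : Xi G) x : xi 1 x = x.
Proof.
suff -> : xi 1 = 1 :> homeo by [].
by apply: (@mulgI _ (xi 1)); rewrite -actM !mulg1.
Qed.

Lemma actMx (G : groupType) (xi : Xi G) g h x : xi (g * h) x = xi g (xi h x).
Proof. by rewrite actM. Qed.

Lemma actVK (G : groupType) (xi : Xi G) g : cancel (xi g^-1) (xi g).
Proof. by move=> x; rewrite -actMx mulgV act1. Qed.

(** Invertibility is automatic: the inverse of [a g] is [a g^-1].  So limits of
    actions and lifted actions need only be checked for continuity. *)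
Lemma mk_action (G : groupType) (a : G -> cantor_space -> cantor_space) :
  (forall g, continuous (a g)) -> (forall x, a 1 x = x) ->
  (forall g h x, a (g * h) x = a g (a h x)) ->
  exists xi : Xi G, forall g x, xi g x = a g x.
Proof.
move=> a_cts a1 aM.
have ah g : homeomorphism (a g).
  split; first exact: a_cts.
  exists (a g^-1); split; first exact: a_cts.
    by move=> x; rewrite -aM mulVg a1.
  by move=> x; rewrite -aM mulgV a1.
have am : {morph (fun g => Homeo (ah g)) : g h / g * h}.
  by move=> g h; apply: homeo_ext => x /=; rewrite aM.
by exists (Action am).
Qed.

Section baire.
Variables (G : groupType) (e : G -> nat).
Hypothesis e_inj : injective e.

Lemma open_act_agree k (xi : Xi G) : open (act_agree e k xi).
Proof.
rewrite openE => eta xieta; apply/(nbhs_actP e_inj); exists k => zeta.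
exact: act_agree_trans.
Qed.

(** A coordinate of the limit depends only on one action of the sequence, hence
    is continuous; multiplicativity then passes to the limit because the
    composition involves one uniformly continuous coordinate function. *)
Lemma act_complete (s : nat -> Xi G) (k : nat -> nat) :
  (forall j, (j <= k j)%N) ->
  (forall i j, (i <= j)%N -> act_agree e (k i) (s i) (s j)) ->
  exists zeta, forall j, act_agree e (k j) (s j) zeta.
Proof.
move=> jk sC.
(* From the index [N g i] on, the sequence is constant at [g] and [i]. *)
pose N g i := maxn (e g).+1 i.+1.
have sE g i j l x : (N g i <= j)%N -> (N g i <= l)%N -> s j g x i = s l g x i.
  wlog jl : j l / (j <= l)%N => [H Nj Nl|Nj _].
    by case/orP: (leq_total j l) => [jl|lj]; [|symmetry]; apply: H.
  move: Nj; rewrite geq_max => /andP[gj ij].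
  by apply: (sC j l jl g); exact: leq_trans (jk j).
pose a g x : cantor_space := fun i => s (N g i) g x i.
have aE g x i j : (N g i <= j)%N -> a g x i = s j g x i.
  by move=> Nj; apply: sE.
have sa j : forall g, (e g < k j)%N -> forall x, agree (k j) (s j g x) (a g x).
  move=> g gj x i ij; rewrite (aE g x i (maxn j (N g i))) ?leq_maxr//.
  by apply: (sC j _ _ g) => //; rewrite leq_maxl.
have a_uniform g i : exists n, forall x y, agree n x y -> a g x i = a g y i.
  have [n nP] := uniform_agree i.+1 (@homeo_continuous (s (N g i) g)).
  by exists n => x y /nP; apply.
have [|x|g h x|zeta zetaE] := @mk_action G a.
- move=> g; apply/continuous_agreeP => x m.
  suff [n nP] : exists n, forall y, agree n x y -> agree m (a g x) (a g y).
    by exists n.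
  elim: m => [|m [n nP]]; first by exists 0.
  have [n' n'P] := a_uniform g m.
  exists (maxn n n') => y xy i; rewrite ltnS leq_eqVlt => /predU1P[->|].
    by apply: n'P; apply: agree_le xy; exact: leq_maxr.
  by apply: nP; apply: agree_le xy; exact: leq_maxl.
- by apply/funext => i; rewrite /a act1.
- apply/funext => i; have [n nP] := a_uniform g i.
  pose j := maxn (maxn (N g i) (N (g * h) i)) (maxn (e h).+1 n).
  have gj : (N g i <= j)%N by rewrite 2!leq_max leqnn.
  have ghj : (N (g * h)%g i <= j)%N by rewrite 2!leq_max leqnn orbT.
  have hj : (e h < j)%N by rewrite leq_max [in X in _ || X]leq_max leqnn orbT.
  have nj : (n <= j)%N by rewrite leq_max [in X in _ || X]leq_max leqnn !orbT.
  rewrite (aE _ _ _ j)// actMx -(aE g _ _ j)//; apply: nP.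
  apply: (agree_le nj); apply: (agree_le (jk j)); apply: sa.
  exact: leq_trans (jk j).
- by exists zeta => j g gj x; rewrite zetaE; exact: sa.
Qed.

Lemma Xi_baire (V : nat -> set (Xi G)) :
  (forall i, open (V i) /\ dense (V i)) -> \bigcap_i V i !=set0.
Proof.
move=> Vod.
have step j (p : Xi G * nat) : exists q : Xi G * nat,
   [/\ (p.2 < q.2)%N, act_agree e p.2 p.1 q.1 & act_agree e q.2 q.1 `<=` V j].
  have [oV dV] := Vod j.
  have [|eta [peta Veta]] := dV _ _ (@open_act_agree p.2 p.1).
    by exists p.1.
  have /(nbhs_actP e_inj)[k kV] := open_nbhs_nbhs (conj oV Veta).
  exists (eta, maxn k p.2.+1) => /=; split=> //; first by rewrite leq_maxr.
  by move=> zeta /(act_agree_le (leq_maxl _ _)) /kV.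
have [xi0 _] := @mk_action G (fun _ => id) (fun _ => @homeo_continuous homeo1)
  (fun=> erefl) (fun _ _ _ => erefl).
pose next j p := projT1 (cid (step j p)).
pose fix s j := if j is i.+1 then next i (s i) else (xi0, 0).
have sP j : [/\ ((s j).2 < (s j.+1).2)%N,
    act_agree e (s j).2 (s j).1 (s j.+1).1 &
    act_agree e (s j.+1).2 (s j.+1).1 `<=` V j].
  exact: projT2 (cid (step j (s j))).
have sk i j : (i <= j)%N -> ((s i).2 <= (s j).2)%N.
  elim: j => [|j IH]; first by rewrite leqn0 => /eqP ->.
  rewrite leq_eqVlt => /predU1P[->//|/IH ij].
  by apply: leq_trans ij (ltnW _); have [] := sP j.
have [||zeta zetaP] := @act_complete (fun j => (s j).1) (fun j => (s j).2).
- by elim=> // j IH; apply: leq_ltn_trans IH _; have [] := sP j.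
- move=> i; elim=> [|j IH]; first by rewrite leqn0 => /eqP ->.
  rewrite leq_eqVlt => /predU1P[->//|ij].
  apply: act_agree_trans (IH ij) _; apply: (act_agree_le (sk i j ij)).
  by have [] := sP j.
by exists zeta => j _; have [_ _] := sP j; apply; exact: zetaP.
Qed.

End baire.

(** * Changing an action outside a finite set of group elements *)

(** ** Coding functions on the group by points of the Cantor space *)
Section coordinates.
Variables (G : groupType) (e : G -> nat).
Hypothesis e_inj : injective e.

(** Only even positions code values: the odd ones are left free, so that the sets
    of codes of functions have no isolated points. *)
Definition coord (g : G) (i : nat) : nat := (pickle (e g, i)).*2.

Lemma coord_inj g h i j : coord g i = coord h j -> g = h /\ i = j.
Proof.
by move=> /double_inj/(pcan_inj pickleK)[/e_inj].
Qed.

Lemma coord_find (k : nat) :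
  {p : option (G * nat) |
    if p is Some (g, i) then coord g i = k else forall g i, coord g i <> k}.
Proof.
have [/cid[[g i] /= <-]|no] := pselect (exists p : G * nat, coord p.1 p.2 = k).
  by exists (Some (g, i)).
by exists None => g i gik; apply: no; exists (g, i).
Qed.

Definition decode (t : cantor_space) (g : G) : cantor_space :=
  fun i => t (coord g i).

(** The point that codes [w] and has the free coordinates of [t]. *)
Definition encode (w : G -> cantor_space) (t : cantor_space) : cantor_space :=
  fun k => if projT1 (coord_find k) is Some (g, i) then w g i else t k.

Lemma encodeK w t : decode (encode w t) = w.
Proof.
apply/funext => g; apply/funext => i; rewrite /decode /encode.
case: (coord_find _) => [[[h j]|]] /=; first by move=> /coord_inj[-> ->].
by move=> /(_ g i).
Qed.

Lemma decodeK t : encode (decode t) t = t.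
Proof.
apply/funext => k; rewrite /decode /encode.
by case: (coord_find _) => [[[h j]|]] //= ->.
Qed.

Lemma encode_encode w v t : encode w (encode v t) = encode w t.
Proof.
apply/funext => k; rewrite /encode.
by case: (projT1 (coord_find _)) => [[]|].
Qed.

Lemma decode_continuous g : continuous (decode^~ g).
Proof.
by apply: continuous_coordP => i; apply: (@proj_continuous _ (fun=> bool)).
Qed.

Definition flip (t : cantor_space) (m : nat) : cantor_space :=
  fun k => if k == m.*2.+1 then ~~ t k else t k.

Lemma decode_flip t m : decode (flip t m) = decode t.
Proof.
apply/funext => g; apply/funext => i; rewrite /decode /flip; case: eqP => //.
by move=> /(congr1 odd); rewrite /= !odd_double.
Qed.

Lemma agree_flip t m : agree m t (flip t m).
Proof.
move=> i im; rewrite /flip; case: eqP => // ie; move: im.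
by rewrite ie ltnNge -addnn -addnS leq_addr.
Qed.

Lemma flip_neq t m : t <> flip t m.
Proof.
move=> /(congr1 (fun x : cantor_space => x m.*2.+1)).
by rewrite /flip eqxx; case: (t _).
Qed.

End coordinates.

Lemma closed_agree n x : closed (agree n x).
Proof.
apply/closed_agreeP => y yn; have [z yz xz] := yn n.
exact: agree_trans xz (agree_sym yz).
Qed.

(** Brouwer's characterization over a map [p] onto the Cantor space: applied in
    each of the finitely many fibres of the first [n] coordinates of [p], it
    gives a parametrization of [T] that fixes these coordinates. *)
Lemma param_over (T : set cantor_space) (p : cantor_space -> cantor_space) n :
  closed T -> continuous p ->
  (forall x, exists2 t, T t & p t = x) ->
  (forall m t, T t -> exists2 t', T t' & [/\ agree m t t', t <> t' & p t' = p t]) ->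
  exists f : cantor_space -> cantor_space,
    [/\ continuous f, injective f, range f = T & forall x, agree n x (p (f x))].
Proof.
move=> T_closed p_cts p_surj T_perfect.
(* [base x] depends only on the cylinder of [x], and selects its fibre. *)
pose base (x : cantor_space) : cantor_space := fun i => (i < n)%N && x i.
have baseE x : agree n (base x) x by move=> i; rewrite /base => ->.
have base_eq x y : agree n x y -> base x = base y.
  by move=> xy; apply/funext => i; rewrite /base; case: ltnP => //= /xy ->.
pose fiber x := T `&` (p @^-1` agree n x).
have /choice[F FP] x : exists f : cantor_space -> cantor_space,
    [/\ continuous f, injective f & range f = fiber x].
  have [t Tt ptx] := p_surj x.
  apply: (@perfect_param _ t); first by split; rewrite //= ptx.
    apply: closedI T_closed _; apply: preimage_closed (@closed_agree n x) => y _.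
    exact: p_cts.
  move=> m u [Tu xu]; have [u' Tu' [uu' nuu' pu']] := T_perfect m u Tu.
  by exists u' => //; split; rewrite //= pu'.
pose tail (x : cantor_space) : cantor_space := fun i => x (n + i)%N.
have F_fiber x y : fiber x (F x y).
  by have [_ _ <-] := FP x; exists y.
exists (fun x => F (base x) (tail x)); split.
- apply/continuous_agreeP => x m.
  have [/continuous_agreeP/(_ (tail x) m)[l lP] _ _] := FP (base x).
  exists (n + l)%N => y xy; rewrite -(base_eq x y); last first.
    by apply: agree_le xy; exact: leq_addr.
  by apply: lP => i il; apply: xy; rewrite ltn_add2l.
- move=> x y E.
  have [_ /= xp] := F_fiber (base x) (tail x).
  have [_ /= yp] := F_fiber (base y) (tail y).
  have xy : agree n x y.
    apply: agree_trans (agree_sym (@baseE x)) _.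
    apply: agree_trans xp _; rewrite E.
    exact: agree_trans (agree_sym yp) (@baseE y).
  move: E; rewrite -(base_eq _ _ xy); have [_ Finj _ /Finj E] := FP (base x).
  apply/funext => i; have [/xy//|ni] := ltnP i n.
  by move: (congr1 (fun z : cantor_space => z (i - n)%N) E); rewrite /tail subnKC.
- rewrite eqEsubset; split=> [_ [x _ <-]|t Tt].
    by have [] := F_fiber (base x) (tail x).
  have [_ _ Fr] := FP (base (p t)).
  have : fiber (base (p t)) t by split => //; exact: baseE.
  rewrite -Fr => -[y _ yt].
  exists (fun i => if (i < n)%N then p t i else y (i - n)%N) => //.
  rewrite -[RHS]yt; congr (F _ _).
    by apply: base_eq => i ->.
  by apply/funext => i; rewrite /tail ltnNge leq_addr addKn.
- move=> x; have [_ /= xp] := F_fiber (base x) (tail x).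
  exact: agree_trans (agree_sym (@baseE x)) xp.
Qed.

(** A continuous injection of a compact space is closed, so its inverse is
    continuous on its image. *)
Lemma lift_continuous (f b : cantor_space -> cantor_space) :
  continuous f -> injective f -> continuous (f \o b) -> continuous b.
Proof.
move=> f_cts f_inj fb_cts; apply/continuous_closedP => C C_closed.
have -> : b @^-1` C = (f \o b) @^-1` (f @` C).
  rewrite eqEsubset; split=> [x Cbx|x [y Cy /f_inj yb]]; last by rewrite /= -yb.
  by exists (b x).
apply: preimage_closed => [x _|]; first exact: fb_cts.
apply: compact_closed; first exact: cantor_space_hausdorff.
apply: continuous_compact; first exact: continuous_subspaceT.
exact: subclosed_compact C_closed cantor_space_compact _.
Qed.

Lemma uniform_action_agree (G : groupType) (e : G -> nat) (xi : Xi G) k :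
  injective e ->
  exists n, forall g, (e g < k)%N -> forall x y,
    agree n x y -> agree k (xi g x) (xi g y).
Proof.
move=> e_inj; suff : forall l, exists n, forall g, (e g < l)%N -> forall x y,
    agree n x y -> agree k (xi g x) (xi g y) by exact.
elim=> [|l [n nP]]; first by exists 0.
have [[g gl]|/forallNP ng] := pselect (exists g, e g = l); last first.
  by exists n => h; rewrite ltnS leq_eqVlt => /predU1P[/ng//|]; exact: nP.
have [m mP] := uniform_agree k (@homeo_continuous (xi g)).
exists (maxn m n) => h hl x y xy; move: hl; rewrite ltnS leq_eqVlt.
case/predU1P => [hl|/nP].
  have -> : h = g by apply: e_inj; rewrite gl.
  by apply: mP; apply: agree_le xy; exact: leq_maxl.
by apply; apply: agree_le xy; exact: leq_maxr.
Qed.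

(** ** Realizing closed invariant sets of functions *)
Section realization.
Variables (G : groupType) (e : G -> nat) (xi : Xi G) (k : nat).
Variable D : set (G -> cantor_space).
Hypothesis e_inj : injective e.
Hypothesis D_closed : closed [set t | D (decode e t)].
Hypothesis D_inv : forall g w, D w -> D (fun h => xi g (w (h * g))).
Hypothesis D_base : forall w g, D w -> (e g < k)%N -> w g = w 1.
Hypothesis D_surj : forall x, exists2 w, D w & w 1 = x.

(** In the action [(g.w)(h) = xi g (w (h g))] on [D], the evaluation at [1]
    intertwines the elements [g] with [e g < k] with [xi].  After a
    parametrization of [D] that is close to this evaluation map, the action is
    close to [xi] at these elements, whereas its return elements to a clopen set
    are computed in [D]. *)
Lemma realization (C : set cantor_space) l :
  (forall x y, agree l x y -> C x -> C y) ->
  exists2 eta, act_agree e k xi eta &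
    forall g, (exists2 x, C x & C (eta g x)) <->
      exists2 w, D w & C (w 1) /\ C (xi g (w g)).
Proof.
move=> C_clopen; have [n0 n0P] := uniform_action_agree xi k e_inj.
pose n := maxn n0 (maxn k l).
have n0n : (n0 <= n)%N by rewrite leq_max leqnn.
have kn : (k <= n)%N by rewrite leq_max [in X in _ || X]leq_max leqnn orbT.
have ln : (l <= n)%N by rewrite leq_max [in X in _ || X]leq_max leqnn !orbT.
pose p t := decode e t 1.
(* The free coordinates of [t] are left fixed by the action. *)
pose a g t := encode e (fun h => xi g (decode e t (h * g))) t.
have dec_a g t h : decode e (a g t) h = xi g (decode e t (h * g)).
  by rewrite /a encodeK.
have [|||f [f_cts f_inj fT fp]] :=
    @param_over [set t | D (decode e t)] p n D_closed.
- exact: decode_continuous.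
- move=> x; have [w Dw wx] := D_surj x; exists (encode e w x); rewrite /p /=.
    by rewrite encodeK.
  by rewrite encodeK.
- move=> m t Dt; exists (flip t m); rewrite /p /= decode_flip//.
  by split; [exact: agree_flip|exact: flip_neq|].
have Df x : D (decode e (f x)).
  have : range f (f x) by exists x.
  by rewrite fT.
have /choice[b bP] (gx : G * cantor_space) :
    exists y, f y = a gx.1 (f gx.2).
  have : [set t | D (decode e t)] (a gx.1 (f gx.2)).
    by rewrite /= /a encodeK//; exact: D_inv.
  by rewrite -fT => -[y _ <-]; exists y.
have a_cts g : continuous (a g).
  apply: continuous_coordP => i; rewrite /a /encode.
  case: (projT1 _) => [[h j]|]; last exact: (@proj_continuous _ (fun=> bool) i).
  move=> t; apply: (@continuous_comp _ cantor_space _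
    (fun t => xi g (decode e t (h * g))) (@proj _ (fun=> bool) j)).
    apply: continuous_comp; first exact: decode_continuous.
    exact: homeo_continuous.
  exact: (@proj_continuous _ (fun=> bool) j).
have [|x|g h x|eta etaE] := @mk_action G (fun g x => b (g, x)).
- move=> g; apply: (lift_continuous f_cts f_inj).
  rewrite (_ : _ \o _ = a g \o f); last by apply/funext => x /=; rewrite bP.
  by move=> x; apply: continuous_comp; [exact: f_cts|exact: a_cts].
- apply: f_inj; rewrite bP /= /a.
  under [X in encode _ X]funext do rewrite mulg1 act1.
  by rewrite decodeK.
- apply: f_inj; rewrite 2!bP /= ?bP /= /a encode_encode; congr encode.
  by apply/funext => h'; rewrite dec_a mulgA actMx.
have pf g x : p (f (eta g x)) = xi g (decode e (f x) g).
  by rewrite etaE bP /p dec_a mul1g.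
have Cf x : C x <-> C (p (f x)).
  have xl : agree l x (p (f x)) by apply: agree_le (fp x).
  by split; apply: C_clopen => //; exact: agree_sym.
exists eta.
  move=> g gk x; apply: (@agree_trans _ (p (f (eta g x)))); last first.
    by apply: agree_sym; apply: agree_le (fp _).
  rewrite pf (D_base (Df x) gk); apply: (n0P _ gk).
  exact: agree_le (fp x).
move=> g; split=> [[x /Cf Cx /Cf]|[w Dw [Cw Cgw]]].
  by rewrite pf => Cgx; exists (decode e (f x)).
have [x _ fx] : range f (encode e w point) by rewrite fT /= encodeK.
exists x; apply/Cf; rewrite ?pf fx ?/p encodeK//.
Qed.

End realization.

(** * Return elements are not locally constant *)

Definition determined (l : nat) (C : set cantor_space) : Prop :=
  forall x y, agree l x y -> C x -> C y.

(** Countably many codes for the clopen sets: a depth and a list of words. *)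
Definition coded (c : nat * seq (seq bool)) : set cantor_space :=
  [set x | mkseq x c.1 \in c.2].

Lemma eq_mkseq_agree n (x y : cantor_space) : agree n x y -> mkseq x n = mkseq y n.
Proof.
by move=> xy; apply/eq_in_map => i; rewrite mem_iota => /andP[_] /xy.
Qed.

Lemma determined_coded c : determined c.1 (coded c).
Proof. by move=> x y /eq_mkseq_agree; rewrite /coded /= => ->. Qed.

Lemma determinedE l C : determined l C -> exists c, coded c = C.
Proof.
move=> C_det; pose ext (t : seq bool) : cantor_space := nth false t.
pose L := [seq tval t | t <- enum {: l.-tuple bool} & `[< C (ext (tval t)) >]].
exists (l, L); rewrite eqEsubset; split=> x; rewrite /coded /=.
  case/mapP => t; rewrite mem_filter => /andP[/asboolP Ct _] xt.
  by apply: C_det Ct => i il; rewrite /ext -xt nth_mkseq.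
move=> Cx; have sx : size (mkseq x l) == l by rewrite size_mkseq.
apply/mapP; exists (Tuple sx) => //; rewrite mem_filter mem_enum andbT.
by apply/asboolP; apply: C_det Cx => i il; rewrite /ext nth_mkseq.
Qed.

Section density.
Variable G : groupType.

Lemma subgroup_generated_closed (A : set G) :
  [/\ subgroup_generated A 1,
      forall g h, subgroup_generated A g -> subgroup_generated A h ->
        subgroup_generated A (g * h) &
      forall g, subgroup_generated A g -> subgroup_generated A g^-1].
Proof.
split=> [M [[M1 _] _]|g h Ag Ah M MA|g Ag M MA].
- by rewrite -inE.
- have [Mc AM] := MA; have := group_closedM Mc; rewrite /mulg_closed => MM.
  by rewrite -inE; apply: MM; rewrite inE; [exact: Ag|exact: Ah].
- have [Mc AM] := MA; have := group_closedV Mc; rewrite /invg_closed => MM.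
  by rewrite -inE; apply: MM; rewrite inE; exact: Ag.
Qed.

Definition returns (eta : Xi G) (C : set cantor_space) (g : G) : Prop :=
  exists2 x, C x & C (eta g x).

Definition avoids (eta : Xi G) (C : set cantor_space) : Prop :=
  exists x, forall g, ~ C (eta g x).

Variables (e : G -> nat).
Hypotheses (e_inj : injective e) (not_fg : ~ finitely_generated G).

(** Near an action with an orbit avoiding [C], the return elements to [C] are not
    determined: outside the proper subgroup [H] they can be enforced, by taking
    independent values on the cosets of [H], or forbidden, by letting at most one
    coset have its value outside [K]. *)
Lemma returns_undetermined (xi : Xi G) k C l :
  determined l C -> C !=set0 -> avoids xi C ->
  exists g eta1 eta2, [/\ act_agree e k xi eta1, act_agree e k xi eta2,
    returns eta1 C g & ~ returns eta2 C g].
Proof.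
move=> C_det [c Cc] [x0 Cx0].
pose F := [set g | (e g < k)%N]; pose H := subgroup_generated F.
have [H1 HM HV] := subgroup_generated_closed F.
have [g1 Hg1] : exists g1, ~ H g1.
  apply: contrapT => /forallNP HT; apply: not_fg; exists F.
    apply: (@finite_preimage _ _ `I_k e) (finite_II k).
    by move=> g h _ _; exact: e_inj.
  by rewrite eqEsubset; split => // g _; apply: contrapT; exact: HT.
have FH g : (e g < k)%N -> H g by move=> gk M [_]; apply.
pose K := [set y | forall g, ~ C (xi g y)].
have KE y g : K y -> K (xi g y).
  by move=> Ky h; rewrite -actMx; exact: Ky.
have K_closed : closed K.
  apply/closed_agreeP => y yK g Cgy.
  have [n nP] := uniform_agree l (@homeo_continuous (xi g)).
  have [z /nP yz Kz] := yK n; apply: (Kz g).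
  exact: C_det yz Cgy.
(* Left [H]-invariance: these are the functions on the cosets [Hg]. *)
pose D1 := [set w : G -> cantor_space | forall h g, H h -> w (h * g) = w g].
(* A value outside [K] is allowed on a single coset. *)
pose D2 := D1 `&` [set w | forall g g', ~ H (g' * g^-1) -> K (w g) \/ K (w g')].
have D1_closed : closed [set t | D1 (decode e t)].
  apply/closed_agreeP => t tD h g Hh; apply/funext => i; rewrite /decode.
  have [u tu Du] := tD (maxn (coord e (h * g) i) (coord e g i)).+1.
  rewrite !tu ?ltnS ?leq_maxl ?leq_maxr//.
  by have := Du h g Hh => /(congr1 (fun z : cantor_space => z i)).
have D2_closed : closed [set t | D2 (decode e t)].
  have -> : [set t | D2 (decode e t)] = [set t | D1 (decode e t)] `&`
      \bigcap_(p in [set p : G * G | ~ H (p.2 * p.1^-1)])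
        ((decode e)^~ p.1 @^-1` K `|` (decode e)^~ p.2 @^-1` K).
    rewrite eqEsubset; split=> t [D1t D2t]; split => //.
      by move=> [g g'] /D2t.
    by move=> g g' Hgg; exact: (D2t (g, g') Hgg).
  apply: (closedI D1_closed).
  apply: closed_bigI => -[g g'] _; apply: closedU;
    by apply: preimage_closed K_closed => t _; exact: decode_continuous.
have D1_inv g w : D1 w -> D1 (fun h => xi g (w (h * g))).
  by move=> D1w h g' Hh /=; rewrite -mulgA (D1w h).
have D2_inv g w : D2 w -> D2 (fun h => xi g (w (h * g))).
  move=> [D1w D2w]; split; first exact: D1_inv.
  move=> h h' Hhh; have [|Kw|Kw] := D2w (h * g) (h' * g).
  - by rewrite invgM mulgA mulgK.
  - by left; exact: KE.
  - by right; exact: KE.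
have D1_base w g : D1 w -> (e g < k)%N -> w g = w 1.
  by move=> D1w /FH Hg; rewrite -[in LHS](mulg1 g) D1w.
have HMl h g : H h -> H (h * g) <-> H g.
  move=> Hh; split; last exact: HM.
  by move=> /(HM _ _ (HV _ Hh)); rewrite mulKg.
pose split_w x y : G -> cantor_space := fun g => if `[< H g >] then x else y.
have D1_split x y : D1 (split_w x y).
  move=> h g Hh; rewrite /split_w; congr (if _ then _ else _).
  by apply/asboolP/asboolP => [/(HMl _ _ Hh)|/(HMl _ _ Hh)].
have split1 x y : split_w x y 1 = x by rewrite /split_w asboolT.
have D2_split x : D2 (split_w x x0).
  split; first exact: D1_split.
  move=> g g' Hgg; rewrite /split_w.
  case: asboolP => Hg; last by left.
  case: asboolP => Hg'; last by right.
  by case: Hgg; apply: HM => //; exact: HV.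
have [eta1 xi1 M1] := realization e_inj D1_closed D1_inv
  (fun w g => @D1_base w g)
  (fun x => ex_intro2 _ _ (split_w x x) (D1_split x x) (split1 x x)) C_det.
have [eta2 xi2 M2] := realization e_inj D2_closed D2_inv
  (fun w g Dw => @D1_base w g Dw.1)
  (fun x => ex_intro2 _ _ (split_w x x0) (D2_split x) (split1 x x0)) C_det.
exists g1, eta1, eta2; split=> //.
  apply/M1; exists (split_w c (xi g1^-1 c)); first exact: D1_split.
  by rewrite split1 /split_w asboolF// actVK.
move=> /M2[w [_ /(_ 1 g1) D2w] [Cw Cgw]].
have [|Kw|Kw] := D2w; first by rewrite invg1 mulg1.
  by apply: (Kw 1); rewrite act1.
exact: (Kw g1).
Qed.

End density.

(** * Patterns and the Baire argument *)

Section pattern.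
Variables (G : groupType) (e : G -> nat).
Hypothesis e_inj : injective e.

Definition pattern (R : set G) (C : set cantor_space) : set (Xi G) :=
  [set eta | avoids eta C /\ returns eta C = R].

Lemma returns_agree eta zeta C l g : determined l C ->
  act_agree e (maxn (e g).+1 l) eta zeta -> returns eta C g -> returns zeta C g.
Proof.
move=> C_det ez [x Cx Cgx]; exists x => //; apply: C_det Cgx.
by apply: (agree_le (leq_maxr (e g).+1 l)); apply: ez; exact: leq_maxl.
Qed.

(** If no orbit of [eta] avoids [C], then by compactness finitely many elements
    suffice to bring every point into [C], and they still do for all nearby
    actions.  Being a return element to a clopen set is a clopen condition. *)
Lemma pattern_closed R C l : determined l C -> closed (pattern R C).
Proof.
move=> C_det; rewrite -[X in closed X]setCK; apply: open_closedC.
rewrite openE => eta eta_out; apply/(nbhs_actP e_inj).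
have [av|nav] := pselect (avoids eta C).
  have /existsNP[g Rg] : ~ forall g, returns eta C g <-> R g.
    move=> mR; apply: eta_out; split=> //; rewrite eqEsubset.
    by split=> g; apply mR.
  exists (maxn (e g).+1 l) => zeta ez [_ mR]; apply: Rg; rewrite -mR.
  by split; apply: (returns_agree C_det) => //; exact: act_agree_sym.
have [||n nP] := @cantor_fan (fun n x => exists2 g, (e g < n)%N & C (eta g x)).
- by move=> i j ij x [g gi Cg]; exists g => //; exact: leq_trans ij.
- move=> x; have /existsNP[g /contrapT Cg] : ~ forall g, ~ C (eta g x).
    by move=> xC; apply: nav; exists x.
  have [n nP] := uniform_agree l (@homeo_continuous (eta g)).
  exists (maxn n (e g).+1) => y xy; exists g; first exact: leq_maxr.
  by apply: C_det Cg; apply: nP; apply: agree_le xy; exact: leq_maxl.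
exists (maxn n l) => zeta ez [[x xC] _]; have [g gn Cg] := nP x.
apply: (xC g); apply: C_det Cg; apply: (agree_le (leq_maxr n l)).
by apply: ez; apply: leq_trans (leq_maxl n l).
Qed.

(** An open set contained in a pattern set would have constant return elements,
    contrary to [returns_undetermined]; [R] is nonempty to exclude an empty [C]. *)
Lemma pattern_nowhere_dense (not_fg : ~ finitely_generated G) R C l :
  determined l C -> R !=set0 -> dense (~` pattern R C).
Proof.
move=> C_det [g Rg] O [xi Oxi] oO; apply: contrapT => OR.
have OR' : O `<=` pattern R C.
  by move=> eta Oeta; apply: contrapT => etaR; apply: OR; exists eta.
have /(nbhs_actP e_inj)[k kO] := open_nbhs_nbhs (conj oO Oxi).
have [avC retC] := OR' _ Oxi.
have C0 : C !=set0 by move: Rg; rewrite -retC => -[x Cx _]; exists x.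
have [h [eta1 [eta2 [/kO/OR'[_ m1] /kO/OR'[_ m2] M1 M2]]]] :=
  @returns_undetermined G e e_inj not_fg xi k C l C_det C0 avC.
by apply: M2; rewrite m2 -m1.
Qed.

Lemma conj_actionE (f : homeo) (xi : Xi G) g x :
  conj_action f xi g x = f (xi g (homeo_inv f x)).
Proof. by []. Qed.

(** Both conditions defining a pattern are invariant under conjugation; this and
    the countability of the clopen sets cover a conjugacy class by countably many
    pattern sets. *)
Lemma pattern_conj (xi : Xi G) (f : homeo) B :
  avoids xi B -> pattern (returns xi B) (f @` B) (conj_action f xi).
Proof.
have fB y : (f @` B) (f y) <-> B y.
  by split=> [[x Bx /(can_inj (@homeoK f)) <-]//|By]; exists y.
move=> [x0 xB]; split.
  by exists (f x0) => g; rewrite conj_actionE homeoK => /fB; exact: xB.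
rewrite eqEsubset; split=> g.
  by move=> [_ [x Bx <-]]; rewrite conj_actionE homeoK => /fB; exists x.
by move=> [x Bx Bgx]; exists (f x); [exists x|rewrite conj_actionE homeoK; apply/fB].
Qed.

Lemma determined_image (f : homeo) B l : determined l B ->
  exists c, coded c = f @` B.
Proof.
move=> B_det; have [n nP] := uniform_agree l (@homeo_continuous (homeo_inv f)).
apply: (@determinedE n) => x y xy [z Bz zx]; exists (homeo_inv f y).
  by apply: B_det Bz; rewrite -(homeoK f z) zx; exact: nP.
exact: homeoVK.
Qed.

(** The orbits in a proper closed invariant set avoid a cylinder around any point
    outside of it. *)
Lemma nonminimal_avoids (xi : Xi G) : ~ minimal_action xi ->
  exists B l, [/\ determined l B, B !=set0 & avoids xi B].
Proof.
move=> /existsNP[F /not_implyP[F_closed /not_implyP[[z Fz] /not_implyP[F_inv FT]]]].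
have /existsNP[y Fy] : ~ forall y, F y.
  by move=> Fall; apply: FT; rewrite eqEsubset; split=> // y _; exact: Fall.
have /existsNP[l lF] : ~ forall l, exists2 x, agree l y x & F x.
  by move=> yF; apply/Fy/(closed_agreeP F).1.
exists (agree l y), l; split; first by move=> u v uv yu; exact: agree_trans uv.
  by exists y.
exists z => g yg; apply: lF; exists (xi g z) => //.
by apply: (F_inv g); exists z.
Qed.

Lemma conj_minimal (f : homeo) (xi : Xi G) :
  minimal_action xi -> minimal_action (conj_action f xi).
Proof.
move=> xi_min F F_closed [z Fz] F_inv.
have fF : f @^-1` F = setT.
  apply: xi_min.
  - by apply: preimage_closed F_closed => x _; exact: homeo_continuous.
  - by exists (homeo_inv f z); rewrite /= homeoVK.
  - move=> g _ [x Fx <-]; apply: (F_inv g); exists (f x) => //.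
    by rewrite conj_actionE homeoK.
rewrite eqEsubset; split=> // x _.
have : (f @^-1` F) (homeo_inv f x) by rewrite fF.
by rewrite /= homeoVK.
Qed.

End pattern.

Theorem corollary1p8 (G : groupType)
  (G_countable : countable [set: G])
  (G_not_fg : ~ finitely_generated G)
  (G_class : exists xi : Xi G, comeager (conjugacy_class xi)) :
  comeager (@Xi_min G).
Proof.
have /countable_injP[e /in2TT e_inj] := G_countable.
have [xi [S S_Gd S_xi]] := G_class.
suff xi_min : minimal_action xi.
  by exists S => // _ /S_xi[f _ <-]; exact: conj_minimal.
apply: contrapT => /nonminimal_avoids[B [l [B_det [b Bb] B_av]]].
have [U U_od SE] := S_Gd.
pose code j : nat * seq (seq bool) := odflt (0, [::]) (unpickle j).
have R0 : returns xi B !=set0 by exists 1, b => //; rewrite act1.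
have [|eta eta_in] :=
    @Xi_baire G e e_inj
      (fun j => U j `&` ~` pattern (returns xi B) (coded (code j))).
  move=> j; have [oU dU] := U_od j.
  have Cm := @determined_coded (code j).
  have oP : open (~` pattern (returns xi B) (coded (code j))).
    by apply: closed_openC; exact: pattern_closed e_inj _ _ _ Cm.
  split; first exact: openI.
  move=> O O0 oO; rewrite setIA.
  apply: (pattern_nowhere_dense e_inj G_not_fg Cm R0); last exact: openI.
  exact: dU.
have /S_xi[f _ f_eta] : S eta by rewrite SE => j _; have [] := eta_in j I.
have [c cE] := determined_image f B_det.
have [_ []] := eta_in (pickle c) I.
by rewrite /code pickleK /= cE -f_eta; exact: pattern_conj.
Qed.
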